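(* Let $n,m,j\in\mathbb{Z}^+$ with $m\ge3$ and $1\le j<m/2$, and let $G(m,j)$ be the generalized Petersen graph. Then: (1) if $8\nmid n$, then $\chi_{n,2}(G(m,j))$ exists; (2) if $8\mid n$ and $2\nmid m$, then $\chi_{n,2}(G(m,j))$ does not exist; (3) if $8\mid n$, $2\mid m$ and $2\nmid j$, then $\chi_{n,2}(G(m,j))$ exists; (4) if $8\mid n$, $2\mid m$, $4\nmid m$ and $2\mid j$, then $\chi_{n,2}(G(m,j))$ exists if and only if $16\nmid n$.
   Context: The generalized Petersen graph $G(m,j)$ has vertex set $\{v_i,u_i: i\in\mathbb{Z}_m\}$ and edge set $\{v_iv_{i+1}, v_iu_i, u_iu_{i+j}: i\in\mathbb{Z}_m\}$ (indices mod $m$). For a graph $G=(V,E)$, a labeling $\ell:V\to\mathbb{Z}$ is proper if adjacent vertices get distinct labels, and it is a closed coloring with remainder $k\bmod n$ if $\sum_{w\in N[v]}\ell(w)\equiv k\pmod n$ for every $v$, where $N[v]$ is the closed neighborhood of $v$. $\chi_{n,k}(G)$ exists iff a proper closed coloring with remainder $k\bmod n$ exists. *)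

(* Defs.v *)
From mathcomp Require Import all_boot all_order all_algebra.

Set Implicit Arguments.
Unset Strict Implicit.
Unset Printing Implicit Defensive.

Import GRing.Theory.
Local Open Scope ring_scope.

(* A finite simple graph is given by its adjacency relation [e : rel V], a
   symmetric and irreflexive relation on a finite type. *)

Section ClosedColoring.

Variables (V : finType) (e : rel V).

Definition closed_nbhd (v : V) : {set V} := [set w | (w == v) || e v w].

Definition proper_labeling (l : V -> int) : Prop :=
  forall x y : V, e x y -> l x <> l y.

Definition closed_coloring (n : nat) (k : int) (l : V -> int) : Prop :=
  forall v : V, (\sum_(w in closed_nbhd v) l w = k %[mod n%:Z])%Z.

(* Properness is required of the integer labels, not of their residues
   modulo [n]. *)
Definition chi_exists (n : nat) (k : int) : Prop :=
  exists l : V -> int, proper_labeling l /\ closed_coloring n k l.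

End ClosedColoring.

(* The outer vertex v_i is [inl i] and the inner vertex u_i is [inr i].
   The type ['Z_m] is the ring of integers modulo [m] only for [1 < m]. *)
Definition gpetersen_vertex (m : nat) : finType := ('Z_m + 'Z_m)%type.

Definition gpetersen (m j : nat) : rel (gpetersen_vertex m) :=
  fun x y => match x, y with
  | inl a, inl b => (b == a + 1) || (a == b + 1)
  | inl a, inr b => a == b
  | inr a, inl b => a == b
  | inr a, inr b => (b == a + j%:R) || (a == b + j%:R)
  end.

Lemma gpetersen_sym (m j : nat) : symmetric (@gpetersen m j).
Proof. by case=> a [] b /=; rewrite /gpetersen ?[a == b]eq_sym // orbC. Qed.

Lemma gpetersen_irr (m j : nat) :
  (3 <= m)%N -> (1 <= j)%N -> (2 * j < m)%N -> irreflexive (@gpetersen m j).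
Proof.
move=> m3 j1 jm; have m1 : (1 < m)%N by apply: leq_trans m3.
have jltm : (j < m)%N by apply: leq_ltn_trans jm; rewrite leq_pmull.
have addK (a b : 'Z_m) : (a == a + b) = (b == 0).
  by rewrite -{1}[a]addr0 (inj_eq (addrI a)) eq_sym.
case=> a; rewrite /gpetersen orbb addK; first exact: oner_eq0.
apply/negP => /eqP/(congr1 (@nat_of_ord _)); rewrite val_Zp_nat // modn_small //.
by move=> j0; rewrite j0 in j1.
Qed.

Arguments gpetersen : clear implicits.

(* Main.v *)
Require Import Defs.
From mathcomp Require Import all_boot all_order all_algebra.
From mathcomp Require Import ring zify.

(** Properness costs nothing: labels may be shifted by multiples of [n].  What
    remains is a linear system over the integers modulo [n] with a symmetric
    matrix.  Its solutions are sought among labelings depending only on the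
    orbit (outer or inner) and, for even [m], on the parity of the index;
    obstructions are vectors of the same shape in the kernel of the matrix,
    modulo 8 in case (2) and modulo 16 in case (4). *)

Set Implicit Arguments.
Unset Strict Implicit.
Unset Printing Implicit Defensive.

Import GRing.Theory.
Local Open Scope ring_scope.

Lemma closed_coloring_dvdP (V : finType) (e : rel V) (n : nat) (k : int)
    (l : V -> int) :
  closed_coloring e n k l <->
  forall v, (n %| \sum_(w in closed_nbhd e v) l w - k)%Z.
Proof. by split=> H v; have := H v; rewrite -eqz_mod_dvd => /eqP. Qed.

(** Replacing each label by its residue plus [n] times the rank of its vertex keeps every sum modulo
    [n] and makes the labels pairwise distinct, since the quotient by [n] recovers the rank. *)
Lemma chi_existsP (V : finType) (e : rel V) (n : nat) (k : int) :
  (0 < n)%N -> irreflexive e ->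
  chi_exists e n k <-> exists l, closed_coloring e n k l.
Proof.
move=> n0 e_irr; split=> [[l [_ lP]]|[l lP]]; first by exists l.
pose r x := (l x %% n)%Z + (enum_rank x * n)%:Z.
have n0Z : n%:Z != 0 by lia.
have rK x : (r x %/ n)%Z = enum_rank x.
  rewrite /r addrC PoszM divzMDl // divz_small ?addr0 //.
  by rewrite modz_ge0 //= ltz_mod.
exists r; split=> [x y exy rxy|].
  suff xy : x = y by rewrite xy e_irr in exy.
  apply: enum_rank_inj; apply: val_inj.
  by apply: (can_inj absz_nat); rewrite -!rK rxy.
apply/closed_coloring_dvdP => v; move/closed_coloring_dvdP: lP => /(_ v).
move=> lv.
have -> : \sum_(w in closed_nbhd e v) r w - k =
   (\sum_(w in closed_nbhd e v) l w - k) +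
   \sum_(w in closed_nbhd e v) (r w - l w).
  by rewrite sumrB; ring.
rewrite rpredD // rpred_sum // => w _.
rewrite /r {2}(divz_eq (l w) n) PoszM.
have -> : (l w %% n)%Z + (enum_rank w)%:Z * n%:Z -
   ((l w %/ n)%Z * n%:Z + (l w %% n)%Z) =
   ((enum_rank w)%:Z - (l w %/ n)%Z) * n%:Z by ring.
exact: dvdz_mull.
Qed.

(** The closed-neighborhood matrix is symmetric, so pairing [w] with the image of [l] equals pairing
    [l] with the image of [w]. Modulo [n] the former is [k * \sum_v w v] and the latter is 0. A
    kernel vector [w] thus obstructs a coloring. *)
Lemma closed_coloring_dual (V : finType) (e : rel V) (n : nat) (k : int)
    (l w : V -> int) :
  symmetric e -> closed_coloring e n k l -> closed_coloring e n 0 w ->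
  (n %| k * \sum_v w v)%Z.
Proof.
move=> e_sym /closed_coloring_dvdP lP /closed_coloring_dvdP wP.
have -> : k * \sum_v w v =
    \sum_x l x * (\sum_(v in closed_nbhd e x) w v - 0)
    - \sum_v w v * (\sum_(x in closed_nbhd e v) l x - k).
  have -> : \sum_x l x * (\sum_(v in closed_nbhd e x) w v - 0) =
            \sum_v w v * \sum_(x in closed_nbhd e v) l x.
    under eq_bigr do rewrite subr0 mulr_sumr.
    under [RHS]eq_bigr do rewrite mulr_sumr.
    rewrite (exchange_big_dep xpredT) //=; apply: eq_bigr => v _.
    apply: eq_big => [x|x _]; last exact: mulrC.
    by rewrite !inE eq_sym e_sym.
  rewrite -sumrB mulr_sumr; apply: eq_bigr => v _; ring.
by rewrite rpredB // rpred_sum // => x _; rewrite dvdz_mull.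
Qed.

Lemma Zp_natr_eq0 (m d : nat) :
  (1 < m)%N -> ((d%:R : 'Z_m) == 0) = (m %| d)%N.
Proof. by move=> m1; rewrite -val_eqE /= val_Zp_nat. Qed.

(** Neither [d] nor [2 * d] vanishes in ['Z_m]. Taken at 1 and at [j], this gives every closed
    neighborhood exactly four vertices. *)
Lemma circulant_uniq (m d : nat) (a : 'Z_m) :
  (0 < d)%N -> (2 * d < m)%N -> uniq [:: a; a + d%:R; a - d%:R].
Proof.
move=> d0 dm; have m1 : (1 < m)%N by lia.
have dN0 : d%:R != 0 :> 'Z_m by rewrite Zp_natr_eq0 // gtnNdvd //; lia.
have ddN0 : (d + d)%:R != 0 :> 'Z_m by rewrite Zp_natr_eq0 // gtnNdvd //; lia.
have aDN b : b != 0 -> a != a + b.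
  by apply: contra => /eqP/esym/(canRL (addKr a)) ->; rewrite addNr.
rewrite /= !inE negb_or !aDN ?oppr_eq0 //= (inj_eq (addrI a)) andbT.
by rewrite -subr_eq0 opprK -natrD.
Qed.

Lemma odd_Zp_addn (m d : nat) (a : 'Z_m) :
  (1 < m)%N -> ~~ odd m -> odd (a + d%:R)%R = odd a (+) odd d.
Proof.
move=> m1 /negbTE mE.
by rewrite /= val_Zp_nat // {2}Zp_cast // modnDmr odd_mod // oddD.
Qed.

Lemma odd_Zp_subn (m d : nat) (a : 'Z_m) :
  (1 < m)%N -> ~~ odd m -> odd (a - d%:R)%R = odd a (+) odd d.
Proof.
by move=> m1 mE; rewrite -[in RHS](subrK d%:R a) odd_Zp_addn // addbK.
Qed.

Lemma sum_Zp_parity (h : nat) (F : bool -> int) :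
  (0 < h)%N -> \sum_(a : 'Z_(2 * h)) F (odd a) = h%:Z * (F false + F true).
Proof.
move=> h0; rewrite -(big_mkord xpredT (F \o odd)) Zp_cast; last by lia.
rewrite mul2n; elim: h {h0} => [|h IHh]; first by rewrite big_nil mul0r.
rewrite doubleS !big_nat_recr //= IHh odd_double /= -addn1 PoszD; ring.
Qed.

Section GPetersenClosedSums.

Variables (m j : nat).
Hypotheses (m3 : (3 <= m)%N) (j0 : (0 < j)%N) (jm : (2 * j < m)%N).

Implicit Types (n : nat) (k : int) (f g : bool -> int).

Lemma sum_closed_nbhd_outer (l : gpetersen_vertex m -> int) (a : 'Z_m) :
  \sum_(w in closed_nbhd (gpetersen m j) (inl a)) l w =
  l (inl a) + l (inl (a + 1%:R)) + l (inl (a - 1%:R)) + l (inr a).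
Proof.
pose s : seq (gpetersen_vertex m) :=
  inr a :: map inl [:: a; a + 1%:R; a - 1%:R].
have s_uniq : uniq s.
  rewrite cons_uniq map_inj_uniq ?circulant_uniq ?andbT //; last by move=> ? ? [].
have sE w : (w \in closed_nbhd (gpetersen m j) (inl a)) = (w \in s).
  case: w => b.
  - by rewrite !inE /= -[a == b + _]subr_eq [_ == b]eq_sym.
  - by rewrite !inE /= eq_sym; apply/esym/orbF.
rewrite (eq_bigl _ _ sE) -big_uniq //= !big_cons big_nil; ring.
Qed.

Lemma sum_closed_nbhd_inner (l : gpetersen_vertex m -> int) (a : 'Z_m) :
  \sum_(w in closed_nbhd (gpetersen m j) (inr a)) l w =
  l (inr a) + l (inr (a + j%:R)) + l (inr (a - j%:R)) + l (inl a).
Proof.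
pose s : seq (gpetersen_vertex m) :=
  inl a :: map inr [:: a; a + j%:R; a - j%:R].
have s_uniq : uniq s.
  rewrite cons_uniq map_inj_uniq ?circulant_uniq ?andbT //; last by move=> ? ? [].
have sE w : (w \in closed_nbhd (gpetersen m j) (inr a)) = (w \in s).
  case: w => b.
  - by rewrite !inE /= eq_sym; apply/esym/orbF.
  - by rewrite !inE /= -[a == b + _]subr_eq [_ == b]eq_sym.
rewrite (eq_bigl _ _ sE) -big_uniq //= !big_cons big_nil; ring.
Qed.

Definition parity_labeling f g (v : gpetersen_vertex m) : int :=
  match v with inl a => f (odd a) | inr a => g (odd a) end.

(** For even [m] parity is well defined on ['Z_m], and the two neighbors of a vertex within its
    orbit have the same parity, whence the factor 2. *)
Lemma closed_coloring_parity n k f g :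
    ~~ odd m ->
    (forall p, (n %| f p + f (~~ p) * 2 + g p - k)%Z) ->
    (forall p, (n %| g p + g (p (+) odd j) * 2 + f p - k)%Z) ->
  closed_coloring (gpetersen m j) n k (parity_labeling f g).
Proof.
move=> mE fP gP; have m1 : (1 < m)%N by lia.
apply/closed_coloring_dvdP => -[a|a].
  rewrite sum_closed_nbhd_outer /parity_labeling odd_Zp_addn ?odd_Zp_subn //.
  by rewrite addbT; have := fP (odd a); rewrite mulr_natr mulr2n addrA.
rewrite sum_closed_nbhd_inner /parity_labeling odd_Zp_addn ?odd_Zp_subn //.
by have := gP (odd a); rewrite mulr_natr mulr2n addrA.
Qed.

Lemma closed_coloring_const n k (x y : int) :
    (n %| 3 * x + y - k)%Z -> (n %| x + 3 * y - k)%Z ->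
  closed_coloring (gpetersen m j) n k
    (parity_labeling (fun=> x) (fun=> y)).
Proof.
move=> xP yP; apply/closed_coloring_dvdP => -[a|a].
  by rewrite sum_closed_nbhd_outer /=; congr (_ %| _)%Z: xP; ring.
by rewrite sum_closed_nbhd_inner /=; congr (_ %| _)%Z: yP; ring.
Qed.

Lemma sum_parity_labeling f g :
  \sum_v parity_labeling f g v =
  \sum_(a : 'Z_m) f (odd a) + \sum_(a : 'Z_m) g (odd a).
Proof. exact: big_sumType. Qed.

End GPetersenClosedSums.

Lemma linear_congruence_solvable (a b n : nat) :
  (0 < a)%N -> (gcdn a n %| b)%N -> exists x : int, (n %| a%:Z * x - b%:Z)%Z.
Proof.
move=> a0 /dvdnP[c ->]; case: (egcdnP n a0) => u v uv _.
exists (u * c)%N%:Z; apply/dvdzP; exists (v * c)%N%:Z.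
by rewrite -!PoszM mulnA [(a * u)%N]mulnC uv; lia.
Qed.

(** The gcd is a power of 2 other than [2 ^ i.+1]. This is the solvability condition of
    [2 ^ i.+1 * x = 2 ^ i] modulo [n]. *)
Lemma dvdn_gcd_pow2 (n i : nat) :
  ~~ (2 ^ i.+1 %| n)%N -> (gcdn (2 ^ i.+1) n %| 2 ^ i)%N.
Proof.
move=> nP; have /(dvdn_pfactor _ _ (isT : prime 2))[t ti tE] :=
  dvdn_gcdl (2 ^ i.+1)%N n.
rewrite tE dvdn_exp2l //; rewrite leq_eqVlt in ti.
case/orP: ti => [/eqP tS|//].
by move: nP; rewrite -tS -tE dvdn_gcdr.
Qed.

Theorem theorem7p6 (n m j : nat)
    (hn : (0 < n)%N) (hm : (3 <= m)%N) (hj : (1 <= j)%N) (hjm : (2 * j < m)%N) :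
  [/\ (~ (8 %| n)%N -> chi_exists (gpetersen m j) n 2%:Z),
      ((8 %| n)%N -> ~ (2 %| m)%N -> ~ chi_exists (gpetersen m j) n 2%:Z),
      ((8 %| n)%N -> (2 %| m)%N -> ~ (2 %| j)%N ->
         chi_exists (gpetersen m j) n 2%:Z) &
      ((8 %| n)%N -> (2 %| m)%N -> ~ (4 %| m)%N -> (2 %| j)%N ->
         (chi_exists (gpetersen m j) n 2%:Z <-> ~ (16 %| n)%N))].
Proof.
have chiP := chi_existsP 2%:Z hn (gpetersen_irr hm hj hjm).
have mono d (l : gpetersen_vertex m -> int) : (d %| n)%N ->
    closed_coloring (gpetersen m j) n 2%:Z l ->
    closed_coloring (gpetersen m j) d 2%:Z l.
  move=> dn /closed_coloring_dvdP lP; apply/closed_coloring_dvdP => v.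
  exact: dvdz_trans (lP v).
split.
- move=> /negP/(@dvdn_gcd_pow2 n 2)/(linear_congruence_solvable (isT : 0 < 8)%N).
  move=> [x xP]; apply/chiP.
  (* The inner label [2 - 3 * x] makes the outer sums exactly 2; the inner sums then require
     [8 * x = 4] modulo [n]. *)
  exists (parity_labeling (fun=> x) (fun=> 2 - 3 * x)).
  apply: closed_coloring_const => //.
    by have -> : 3 * x + (2 - 3 * x) - 2%:Z = 0 by ring.
  have -> : x + 3 * (2 - 3 * x) - 2%:Z = - (8%N%:Z * x - 4%N%:Z) by ring.
  by rewrite rpredN.
- move=> n8 /negP mO /chiP[l /(mono 8%N _ n8) lP].
  (* The closed sums of this vector are 8 and 16. Its total is [6 * m], so duality gives that 8
     divides [12 * m], which fails for odd [m]. *)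
  have wP : closed_coloring (gpetersen m j) 8 0
      (parity_labeling (fun=> 1) (fun=> 5)).
    exact: closed_coloring_const.
  have := closed_coloring_dual (@gpetersen_sym m j) lP wP.
  by rewrite sum_parity_labeling !sumr_const card_ord Zp_cast; lia.
- move=> _ m2 /negP j2; apply/chiP.
  (* With [j] odd, an even vertex sees only itself and its spoke partner labeled 1, and an odd
     vertex only its two neighbors in its own orbit: every sum is exactly 2. *)
  exists (parity_labeling (fun p => (~~ p)%:Z) (fun p => (~~ p)%:Z)).
  have jO : odd j by lia.
  by apply: closed_coloring_parity => // [|[]|[]]; rewrite ?jO ?dvdz0 //; lia.
move=> n8 m2 /negP m4 j2; have jE : odd j = false by lia.
split=> [/chiP[l lP]|/negP].
  move=> n16; have := mono 16%N _ n16 lP => {}lP.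
  (* With [j] even, the factor -3 on the outer orbit makes the inner sums 0; the outer sums are 0 at
     even and 16 at odd indices. For [m = 2 * h] the total is [4 * h], so 16 would divide [8 * h],
     making [h] even against [m4]. *)
  pose w (p : bool) : int := if p then 1 else -3.
  have wP : closed_coloring (gpetersen m j) 16 0
      (parity_labeling (fun p => -3 * w p) w).
    by apply: closed_coloring_parity => // [|[]|[]]; rewrite ?jE /w /=; lia.
  have := closed_coloring_dual (@gpetersen_sym m j) lP wP.
  have [h mE] : exists h, m = (2 * h)%N by exists (m %/ 2)%N; lia.
  rewrite sum_parity_labeling mE (sum_Zp_parity (fun p => -3 * w p)); last by lia.
  rewrite (sum_Zp_parity w) /w; last by lia.
  lia.
move=> /(@dvdn_gcd_pow2 n 3)/(linear_congruence_solvable (isT : 0 < 16)%N).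
move=> [x xP]; apply/chiP.
(* The outer label [2 - 3 * g p] solves the inner equations exactly, and the even value of [g] is
   chosen to solve the outer ones at even indices. Those at odd indices become [16 * x = 8] modulo
   [n], which is [xP]. *)
pose g (p : bool) := if p then x else 2 - 3 * x.
exists (parity_labeling (fun p => 2 - 3 * g p) g).
apply: closed_coloring_parity => // [|[]|[]]; rewrite ?jE /g /=; first by lia.
  by congr (_ %| _)%Z: xP; ring.
all: by rewrite [X in (_ %| X)%Z](_ : _ = 0) ?dvdz0 //; ring.
Qed.
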